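(* Let $\Gamma$ be a Coxeter graph with associated (full) Artin group $A$. If $\Gamma$ contains an $A_2$ subgraph, then $A$ is not residually free.
   Context: A Coxeter graph $\Gamma$ is a finite simple graph with vertex set $S$ in which each edge $\{s,t\}$ carries a value $m_{s,t}\in\{3,4,5,\dots\}\cup\{\infty\}$; an edge is unlabelled when $m_{s,t}=3$, and $m_{s,t}=2$ for distinct non-adjacent $s,t$. The associated Artin group $A$ has generating set $S$ and relations $sts\cdots=tst\cdots$ ($m_{s,t}$ factors on each side) for all distinct $s,t\in S$ with $m_{s,t}<\infty$. $\Gamma$ contains an $A_k$ subgraph if it contains, as a vertex-induced subgraph, a path on $k$ vertices all of whose edges are unlabelled. (So an $A_2$ subgraph is a single unlabelled edge.) A group $G$ is residually free if for every $x\neq 1$ in $G$ there is a homomorphism $f$ from $G$ to a free group $F$ with $f(x)\neq 1$. *)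

(* Defs.v *)
From HB Require Import structures.
From mathcomp Require Import all_boot.
From mathcomp Require Import boolp.

Set Implicit Arguments.
Unset Strict Implicit.
Unset Printing Implicit Defensive.

Local Open Scope quotient_scope.

(* The letter (x, true) stands for the generator x, (x, false) for its
   inverse. *)
Definition word (X : Type) := seq (X * bool).

Definition posword (X : Type) (s : seq X) : word X := [seq (x, true) | x <- s].

Definition invword (X : Type) (w : word X) : word X :=
  rev [seq (l.1, ~~ l.2) | l <- w].

(* The congruence on words generated by free reduction and by the relations
   u = v for which R u v holds. *)
Inductive pres_eq (X : Type) (R : word X -> word X -> Prop) :
    word X -> word X -> Prop :=
| PresRefl u : pres_eq R u u
| PresSym u v : pres_eq R u v -> pres_eq R v u
| PresTrans u v w : pres_eq R u v -> pres_eq R v w -> pres_eq R u w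
| PresCat u u' v v' :
    pres_eq R u u' -> pres_eq R v v' -> pres_eq R (u ++ v) (u' ++ v')
| PresCancel x b : pres_eq R [:: (x, b); (x, ~~ b)] [::]
| PresRel u v : R u v -> pres_eq R u v.

Section Presented.
Variables (X : choiceType) (R : word X -> word X -> Prop).

Definition pres_eqb (u v : word X) : bool := `[< pres_eq R u v >].

Lemma pres_eqb_refl : reflexive pres_eqb.
Proof. by move=> u; apply/asboolP; exact: PresRefl. Qed.

Lemma pres_eqb_sym : symmetric pres_eqb.
Proof. by move=> u v; apply/asboolP/asboolP; exact: PresSym. Qed.

Lemma pres_eqb_trans : transitive pres_eqb.
Proof.
move=> v u w /asboolP uv /asboolP vw.
by apply/asboolP; exact: PresTrans uv vw.
Qed.

Definition pres_equiv : equiv_rel (word X) :=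
  EquivRel pres_eqb pres_eqb_refl pres_eqb_sym pres_eqb_trans.

(* The group presented by the generators X and the relations R. *)
Definition presented : Type := {eq_quot pres_equiv}.

HB.instance Definition _ := Choice.on presented.

Definition pres_class (w : word X) : presented := \pi_({eq_quot pres_equiv}) w.

Definition pres_mul (a b : presented) : presented :=
  pres_class (repr (a : {eq_quot pres_equiv})
    ++ repr (b : {eq_quot pres_equiv})).

Definition pres_inv (a : presented) : presented :=
  pres_class (invword (repr (a : {eq_quot pres_equiv}))).

Definition pres_one : presented := pres_class [::].

Lemma pres_classP u v : pres_class u = pres_class v <-> pres_eq R u v.
Proof.
by split=> [/eqquotP /asboolP //|uv]; apply/eqquotP; apply/asboolP.
Qed.

Lemma pres_classK (a : presented) :
  pres_class (repr (a : {eq_quot pres_equiv})) = a.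
Proof. exact: reprK. Qed.

Lemma pres_mulE u v :
  pres_mul (pres_class u) (pres_class v) = pres_class (u ++ v).
Proof. by apply/pres_classP; apply: PresCat; apply/pres_classP/pres_classK. Qed.

Lemma invwordl u : pres_eq R (invword u ++ u) [::].
Proof.
elim: u => [|[x b] u IH]; first exact: PresRefl.
rewrite /invword /= rev_cons cat_rcons.
apply: (PresTrans _ IH); apply: PresCat; first exact: PresRefl.
have := PresCat (PresCancel R x (~~ b)) (PresRefl R u).
by rewrite negbK.
Qed.

Lemma invwordK (u : word X) : invword (invword u) = u.
Proof.
rewrite /invword map_rev revK -map_comp -[RHS]map_id; apply: eq_map.
by case=> x b /=; rewrite negbK.
Qed.

Lemma invwordr u : pres_eq R (u ++ invword u) [::].
Proof. by have := invwordl (invword u); rewrite invwordK. Qed.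

Lemma invword_eq u v : pres_eq R u v -> pres_eq R (invword u) (invword v).
Proof.
move=> uv; apply: (@PresTrans _ _ _ (invword u ++ (v ++ invword v))).
  apply: PresSym; rewrite -[X in pres_eq R _ X]cats0.
  by apply: PresCat; [exact: PresRefl | exact: invwordr].
rewrite catA -[X in pres_eq R _ X]cat0s.
apply: PresCat; last exact: PresRefl.
apply: PresTrans (invwordl u).
by apply: PresCat; [exact: PresRefl | exact: PresSym].
Qed.

Lemma pres_invE u : pres_inv (pres_class u) = pres_class (invword u).
Proof. by apply/pres_classP/invword_eq/pres_classP/pres_classK. Qed.

Lemma pres_mulA : associative pres_mul.
Proof.
move=> a b c; rewrite -(pres_classK a) -(pres_classK b) -(pres_classK c).
by rewrite !pres_mulE catA.
Qed.

Lemma pres_mul1g : left_id pres_one pres_mul.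
Proof. by move=> a; rewrite -(pres_classK a) pres_mulE. Qed.

Lemma pres_mulg1 : right_id pres_one pres_mul.
Proof. by move=> a; rewrite -(pres_classK a) pres_mulE cats0. Qed.

Lemma pres_mulVg : left_inverse pres_one pres_inv pres_mul.
Proof.
move=> a; rewrite -(pres_classK a) pres_invE pres_mulE.
by apply/pres_classP/invwordl.
Qed.

Lemma pres_mulgV : right_inverse pres_one pres_inv pres_mul.
Proof.
move=> a; rewrite -(pres_classK a) pres_invE pres_mulE.
by apply/pres_classP/invwordr.
Qed.

HB.instance Definition _ := isGroup.Build presented
  pres_mulA pres_mul1g pres_mulg1 pres_mulVg pres_mulgV.

End Presented.

Definition free_group (X : choiceType) : groupType :=
  presented (fun _ _ : word X => False).

(* The basis X ranges over all choice types: free groups of arbitrary,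
   possibly infinite, rank are allowed. *)
Definition residually_free (G : groupType) : Prop :=
  forall x : G, x <> 1%g ->
    exists (X : choiceType) (f : {multiplicative G -> free_group X}),
      f x <> 1%g.

(* [label s t] is only meaningful on edges; None stands for the label oo. *)
Record coxeter_graph := CoxeterGraph {
  vertex :> finType;
  edge : rel vertex;
  label : vertex -> vertex -> option nat;
  edge_sym : symmetric edge;
  edge_irrefl : irreflexive edge;
  label_sym : forall s t, edge s t -> label s t = label t s;
  label_ge3 : forall s t m, edge s t -> label s t = Some m -> 3 <= m
}.

(* m_{s,t} for distinct vertices s and t. *)
Definition coxeter_m (Gam : coxeter_graph) (s t : Gam) : option nat :=
  if edge s t then label s t else Some 2.

(* The sequence s, t, s, t, ... of length n. *)
Fixpoint alternating (X : Type) (s t : X) (n : nat) : seq X :=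
  if n is n'.+1 then s :: alternating t s n' else [::].

Definition artin_rel (Gam : coxeter_graph) (u v : word Gam) : Prop :=
  exists s t m, [/\ s != t, coxeter_m s t = Some m,
    u = posword (alternating s t m) & v = posword (alternating t s m)].

Definition artin_group (Gam : coxeter_graph) : groupType :=
  presented (@artin_rel Gam).

(* The vertices p 0, ..., p (k - 1) induce a path, in this order, all of whose
   edges are unlabelled. *)
Definition has_A_subgraph (Gam : coxeter_graph) (k : nat) : Prop :=
  exists p : 'I_k -> Gam,
    [/\ injective p,
        forall i j : 'I_k, edge (p i) (p j) = (i.+1 == j) || (j.+1 == i)
      & forall i j : 'I_k, edge (p i) (p j) -> label (p i) (p j) = Some 3].

(* Main.v *)
Require Import Defs.
From mathcomp Require Import all_boot.
From mathcomp Require Import all_algebra all_field.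

Set Implicit Arguments.
Unset Strict Implicit.
Unset Printing Implicit Defensive.

Import GRing.Theory Num.Theory.

(** An unlabelled edge {s, t} gives a braid relation sts = tst in the Artin
group.  The argument shows that s t^-1 is a nontrivial element which every
homomorphism to a free group kills.

In a free group, aba = bab forces a = b ([free_group_braid]).  Indeed
D = aba satisfies Da = bD and Db = aD.  If a and b are represented by
upper unitriangular integer matrices, then C = a - b satisfies DC = - CD;
since D is 1 plus a strictly upper triangular matrix, the first possibly
nonzero superdiagonal of C equals its own opposite, so C = 0
([unitriangular_braid]).  Such representations separate the elements of a free
group: this is the Magnus embedding, truncated and projected so as to
detect one given nonempty reduced product of syllables ([spell_corner]).

In the Artin group, distinct generators are distinct elements
([artin_generator_inj]).  They act by the reflections 1 - E_s of a geometric
representation over the algebraic numbers, with E_s E_t E_s = c E_s and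
c = 2 + q + q^-1 for a primitive m_{s,t}-th root of unity q.  The product of
two such reflections is annihilated by (X - q)(X - q^-1)(X - 1), a divisor of
X^m - 1 when m > 2, so that it has order dividing m
([reflection_product_order]); for involutions this is the braid relation of
length m ([alternating_braid]). *)

(** * Words and presented groups *)

Section PresentedGroups.
Variables (X : choiceType) (R : word X -> word X -> Prop).

Lemma pres_class_surj (a : presented R) : exists u, a = pres_class R u.
Proof. by exists (repr a); rewrite pres_classK. Qed.

Lemma pres_classM u v :
  (pres_class R u * pres_class R v)%g = pres_class R (u ++ v).
Proof. exact: pres_mulE. Qed.

End PresentedGroups.

Section Evaluation.
Local Open Scope ring_scope.
Variables (X : Type) (A : pzRingType) (g : X * bool -> A).

Definition eval_word (w : word X) : A := \prod_(l <- w) g l.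

Lemma eval_cat u v : eval_word (u ++ v) = eval_word u * eval_word v.
Proof. exact: big_cat. Qed.

(** The universal property of a presentation, for values in the units of a
ring. *)
Lemma eval_pres_eq (R : word X -> word X -> Prop) :
    (forall x b, g (x, b) * g (x, ~~ b) = 1) ->
    (forall u v, R u v -> eval_word u = eval_word v) ->
  forall u v, pres_eq R u v -> eval_word u = eval_word v.
Proof.
move=> gV gR u v; elim=> {u v}.
- by [].
- by move=> u v _ ->.
- by move=> u v w _ -> _ ->.
- by move=> u u' v v' _ euu _ evv; rewrite !eval_cat euu evv.
- by move=> x b; rewrite /eval_word !big_cons big_nil mulr1 gV.
- exact: gR.
Qed.

End Evaluation.

(** * The geometric representation of an Artin group *)

Section Reflections.
Local Open Scope ring_scope.

Lemma sub1_involutive (A : pzRingType) (x : A) :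
  x * x = x *+ 2 -> (1 - x) * (1 - x) = 1.
Proof.
by move=> xx; rewrite mulrBl !mulrBr !mul1r mulr1 xx mulr2n opprB addrK subrK.
Qed.

(** With P the product of the two reflections, P + P^-1 acts on x, and by
symmetry on y, as a scalar.  This gives the quadratic equation satisfied by P
on the right ideal generated by x and y, which contains P - 1. *)
Lemma reflection_sum_eigen (K : fieldType) (A : algType K) (x y : A) (c : K) :
    x * x = x *+ 2 -> x * y * x = (2 + c) *: x ->
  ((1 - x) * (1 - y) + (1 - y) * (1 - x)) * x = c *: x.
Proof.
move=> xx xyx.
have axx : (1 - x) * x = - x by rewrite mulrBl mul1r xx mulr2n opprD addNKr.
rewrite mulrDl.
have -> : (1 - x) * (1 - y) * x = - x - y * x + (x + x + c *: x).
  rewrite -mulrA (mulrBl x) mul1r mulrBr axx mulrBl mul1r mulrA xyx opprB.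
  by rewrite scalerDl scaler_nat mulr2n addrA addrAC.
have -> : (1 - y) * (1 - x) * x = y * x - x.
  by rewrite -mulrA axx mulrN mulrBl mul1r opprB.
set u := y * x; set v := c *: x.
by rewrite addrAC (addrA (- x - u)) subrK -opprD addKr.
Qed.

(** P satisfies (P - q)(P - q^-1)(P - 1) = 0, and for m > 2 the three roots are
distinct m-th roots of unity. For m = 2 the roots q and q^-1 coincide, and
the order may be infinite. *)
Lemma reflection_product_order (K : fieldType) (A : algType K) (x y : A)
    (q : K) (m : nat) :
    (2 < m)%N -> m.-primitive_root q ->
    x * x = x *+ 2 -> y * y = y *+ 2 ->
    x * y * x = (2 + (q + q^-1)) *: x -> y * x * y = (2 + (q + q^-1)) *: y ->
  ((1 - x) * (1 - y)) ^+ m = 1.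
Proof.
move=> m_gt2 qm xx yy xyx yxy.
set P := (1 - x) * (1 - y); set Q := (1 - y) * (1 - x); set c := q + q^-1.
have q0 : q != 0 by rewrite (prim_root_eq0 qm) -lt0n (ltn_trans _ m_gt2).
have PQ : P * Q = 1.
  rewrite /P /Q mulrA -(mulrA (1 - x)) sub1_involutive // mulr1.
  exact: sub1_involutive.
have annih : (P + Q - c%:A) * (P - 1) = 0.
  have -> : P - 1 = x * y - x - y.
    rewrite /P mulrBl mul1r mulrBr mulr1 opprB addrAC (addrAC 1) subrr sub0r.
    by rewrite addrC.
  have eig z : (P + Q) * z = c *: z -> (P + Q - c%:A) * z = 0.
    by rewrite mulrBl mulr_algl => ->; rewrite subrr.
  have ax : (P + Q - c%:A) * x = 0 by apply/eig/reflection_sum_eigen.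
  have ay : (P + Q - c%:A) * y = 0.
    by apply: eig; rewrite addrC; apply: reflection_sum_eigen.
  by rewrite !mulrBr mulrA ax ay mul0r !subr0.
have fac : (P - q%:A) * (P - q^-1%:A) = P * (P + Q - c%:A).
  rewrite mulrBl !mulrBr !mulr_algr mulr_algl mulrDr PQ scalerDl.
  rewrite scalerA mulVf // scale1r opprB addrA (addrAC (P * P)).
  by rewrite opprD addrA [RHS]addrAC.
pose p : {poly K} := \prod_(z <- [:: q; q^-1; 1]) ('X - z%:P).
have pP : horner_alg P p = 0.
  rewrite /p !big_cons big_nil mulr1 !rmorphM !rmorphB /=.
  rewrite !horner_algX !horner_algC.
  by rewrite scale1r mulrA fac -mulrA annih mulr0.
have /dvdpP[r Dr] : (p %| 'X^m - 1)%R.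
  apply: uniq_roots_dvdp.
    rewrite /= !rootE !hornerE exprVn (prim_expr_order qm) invr1.
    by rewrite expr1n subrr eqxx.
  rewrite uniq_rootsE /= !inE negb_or andbT invr_eq1.
  have qn k : (0 < k < m)%N -> q ^+ k != 1.
    by case/andP=> k0 km; rewrite -(prim_order_dvd qm) gtnNdvd.
  have q1 : q != 1 by rewrite -[q]expr1 qn // (ltn_trans _ m_gt2).
  rewrite q1 !andbT; apply: contra (qn 2 m_gt2) => /eqP qV.
  by rewrite expr2 {2}qV divff.
have /(congr1 (horner_alg P)) := Dr.
rewrite rmorphM /= pP mulr0 rmorphB rmorphXn /= horner_algX rmorph1.
by move/eqP; rewrite subr_eq0 => /eqP.
Qed.

(** The two alternating words spell one of length 2m: the reversal of
[alternating t s m] begins with the letter that continues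
[alternating s t m]. *)
Lemma eval_alternating (A : pzRingType) (T : Type) (g : T -> A) s t m :
  \prod_(x <- alternating s t m) g x * \prod_(x <- rev (alternating t s m)) g x
  = (g s * g t) ^+ m.
Proof.
elim: m s t => [|m IH] s t /=; first by rewrite !big_nil mulr1.
rewrite rev_cons big_cons big_rcons /= mulrA -(mulrA (g s)) IH.
elim: m {IH} => [|m IH]; first by rewrite mulr1.
by rewrite exprS [RHS]exprS -IH !mulrA.
Qed.

Lemma alternating_braid (A : pzRingType) (T : Type) (g : T -> A) s t m :
    (forall x, g x * g x = 1) -> (g s * g t) ^+ m = 1 ->
  \prod_(x <- alternating s t m) g x = \prod_(x <- alternating t s m) g x.
Proof.
move=> gg gst.
have revK (r : seq T) : \prod_(x <- rev r) g x * \prod_(x <- r) g x = 1.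
  elim: r => [|x r IH]; first by rewrite !big_nil mulr1.
  by rewrite rev_cons big_rcons big_cons /= mulrA -(mulrA _ (g x) (g x)) gg
    mulr1.
have := congr1 ( *%R^~ (\prod_(x <- alternating t s m) g x))
  (eval_alternating g s t m).
by rewrite /= -mulrA revK mulr1 gst mul1r.
Qed.

Variable Gam : coxeter_graph.

Definition coxeter_root (m : nat) : algC :=
  if insub m : {? k | (0 < k)%N} is Some k
  then sval (C_prim_root_exists (valP k)) else 1.

Lemma coxeter_rootP m : (0 < m)%N -> m.-primitive_root (coxeter_root m).
Proof.
rewrite /coxeter_root; case: insubP => [k _ <- _|/negP//].
by case: (C_prim_root_exists _).
Qed.

Lemma coxeter_root2 : coxeter_root 2 = -1.
Proof.
have q2 : 2.-primitive_root (coxeter_root 2) by exact: coxeter_rootP.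
have /eqP := prim_expr_order q2; rewrite sqrf_eq1 => /orP[|/eqP//].
by rewrite -[X in X == 1]expr1 -(prim_order_dvd q2).
Qed.

(** A symmetric choice with [gram s t * gram t s] = 4 cos^2 (k pi / m) for some
k prime to m. *)
Definition gram (s t : Gam) : algC :=
  if s == t then 2
  else if coxeter_m s t is Some m
       then sqrtC (2 + (coxeter_root m + (coxeter_root m)^-1)) else 0.

(** The index set gets one extra element, since only matrices of manifestly
positive size form a nontrivial ring. *)
Definition vertex_index (s : Gam) : 'I_(#|Gam|.+1) := lift ord0 (enum_rank s).

Lemma vertex_index_inj : injective vertex_index.
Proof. by move=> s t /lift_inj/enum_rank_inj. Qed.

Definition root_col (s : Gam) : 'cV[algC]_(#|Gam|.+1) :=
  delta_mx (vertex_index s) 0.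

Definition root_row (s : Gam) : 'rV[algC]_(#|Gam|.+1) :=
  \sum_t gram s t *: delta_mx 0 (vertex_index t).

Definition root_mx (s : Gam) : 'M[algC]_(#|Gam|.+1) :=
  root_col s *m root_row s.

Lemma root_row_col s t : root_row s *m root_col t = (gram s t)%:M.
Proof.
rewrite /root_row mulmx_suml (bigD1 t) //= big1 => [|u ut].
  rewrite addr0 -scalemxAl mul_delta_mx.
  by apply/matrixP=> i j; rewrite !ord1 !mxE eqxx mulr1.
rewrite -scalemxAl mul_delta_mx_0 ?scaler0 //.
by rewrite (inj_eq vertex_index_inj).
Qed.

Lemma root_mxM s t :
  root_mx s * root_mx t = gram s t *: (root_col s *m root_row t).
Proof.
rewrite /root_mx -[LHS]mulmxA (mulmxA (root_row s)) root_row_col.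
by rewrite mul_scalar_mx scalemxAr.
Qed.

Lemma root_mxMM s t :
  root_mx s * root_mx t * root_mx s = (gram s t * gram t s) *: root_mx s.
Proof.
rewrite root_mxM -scalerAl -scalerA; congr (_ *: _).
rewrite /root_mx -[LHS]mulmxA (mulmxA (root_row t)) root_row_col.
by rewrite mul_scalar_mx scalemxAr.
Qed.

Lemma root_mx_sq s : root_mx s * root_mx s = root_mx s *+ 2.
Proof. by rewrite root_mxM /gram eqxx scaler_nat. Qed.

Definition reflection (s : Gam) : 'M[algC]_(#|Gam|.+1) := 1 - root_mx s.

Lemma reflectionK s : reflection s * reflection s = 1.
Proof.
exact/sub1_involutive/root_mx_sq.
Qed.

Lemma coxeter_mC s t : @coxeter_m Gam s t = coxeter_m t s.
Proof.
by rewrite /coxeter_m (edge_sym s t); case: ifP => // /label_sym->.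
Qed.

Lemma coxeter_m_ge2 s t m : @coxeter_m Gam s t = Some m -> (2 <= m)%N.
Proof.
by rewrite /coxeter_m; case: ifP => [st /(label_ge3 st)/ltnW|_ [<-]].
Qed.

Lemma gramM s t m : s != t -> coxeter_m s t = Some m ->
  gram s t * gram t s = 2 + (coxeter_root m + (coxeter_root m)^-1).
Proof.
move=> /negPf st mst; rewrite /gram (eq_sym t) st (coxeter_mC t) mst -expr2.
exact: sqrtCK.
Qed.

(** For m = 2, [gram s t] = 0, so the reflections are commuting involutions; for
m > 2 their product is diagonalizable. *)
Lemma reflection_order s t m : s != t -> coxeter_m s t = Some m ->
  (reflection s * reflection t) ^+ m = 1.
Proof.
move=> st mst; have := coxeter_m_ge2 mst; rewrite leq_eqVlt => /orP[/eqP m2|m3].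
  have gram0 u v : u != v -> coxeter_m u v = Some m -> gram u v = 0.
    rewrite /gram -m2 => /negPf-> ->.
    by rewrite coxeter_root2 invrN1 addrA addrK subrr sqrtC0.
  have st0 : root_mx s * root_mx t = 0 by rewrite root_mxM gram0 ?scale0r.
  have ts0 : root_mx t * root_mx s = 0.
    by rewrite root_mxM gram0 ?scale0r // 1?eq_sym // coxeter_mC.
  have comm : reflection s * reflection t = reflection t * reflection s.
    by rewrite /reflection !mulrBl !mulrBr !mul1r !mulr1 st0 ts0 !subr0 addrAC.
  rewrite -m2 expr2 {2}comm mulrA -(mulrA (reflection s)) reflectionK mulr1.
  exact: reflectionK.
have m0 : (0 < m)%N by exact: ltn_trans m3.
apply: reflection_product_order m3 (coxeter_rootP m0) _ _ _ _.
- exact: root_mx_sq.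
- exact: root_mx_sq.
- by rewrite root_mxMM (gramM st mst).
- by rewrite root_mxMM mulrC (gramM st mst).
Qed.

Lemma root_mx_inj : injective root_mx.
Proof.
move=> s t est; apply/eqP; apply: contraT => st.
have := congr1 (fun M : 'M_ _ => (M *m root_col s) (vertex_index s) 0) est.
rewrite /root_mx -!mulmxA !root_row_col !mul_mx_scalar /root_col !mxE eqxx.
rewrite (inj_eq vertex_index_inj) (negPf st) /gram !eqxx mulr0 mulr1 => /eqP.
by rewrite pnatr_eq0.
Qed.

(** The reflections are involutions, so a generator and its inverse have the
same image. *)
Lemma artin_generator_inj (s t : Gam) :
  pres_eq (@artin_rel Gam) [:: (s, true)] [:: (t, true)] -> s = t.
Proof.
move=> st; suff: eval_word (fun l => reflection l.1) [:: (s, true)]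
    = eval_word (fun l => reflection l.1) [:: (t, true)].
  by rewrite /eval_word !big_seq1 => /addrI/oppr_inj; exact: root_mx_inj.
apply: eval_pres_eq st => [x b|]; first exact: reflectionK.
move=> _ _ [x [y [m [xy mxy -> ->]]]]; rewrite /eval_word !big_map /=.
apply: alternating_braid => [z|]; first exact: reflectionK.
exact: reflection_order.
Qed.

End Reflections.

(** * The braid relation in unitriangular matrices *)

Section UnitriangularMatrices.
Local Open Scope ring_scope.
Variable n : nat.
Implicit Types A B C : 'M[int]_n.+1.

(** The multiplicative filtration by superdiagonals: the entries below the d-th
one vanish. *)
Definition above d A := forall i j : 'I_n.+1, (j < i + d)%N -> A i j = 0.

Lemma aboveD d A B : above d A -> above d B -> above d (A + B).
Proof. by move=> hA hB i j ij; rewrite mxE hA ?hB ?addr0. Qed.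

Lemma aboveM d e A B : above d A -> above e B -> above (d + e) (A * B).
Proof.
move=> hA hB i j ij; rewrite mxE big1 // => k _.
have [kd|dk] := ltnP k (i + d); first by rewrite hA ?mul0r.
rewrite hB ?mulr0 // (leq_trans ij) // addnA leq_add2r //.
Qed.

Lemma above_eq0 A : above n.+1 A -> A = 0.
Proof.
move=> hA; apply/matrixP=> i j; rewrite mxE hA //.
by rewrite (leq_trans (ltn_ord j)) // leq_addl.
Qed.

Definition unitriangular A := above 1 (A - 1).

Lemma unitriangular1 : unitriangular 1.
Proof. by move=> i j _; rewrite subrr mxE. Qed.

Lemma unitriangularM A B :
  unitriangular A -> unitriangular B -> unitriangular (A * B).
Proof.
move=> uA uB; rewrite /unitriangular.
have -> : A * B - 1 = (A - 1) * (B - 1) + ((A - 1) + (B - 1)).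
  rewrite mulrBr mulr1 addrA subrK mulrBl mul1r.
  by rewrite addrA subrK.
apply: aboveD; last exact: aboveD.
by move=> i j ij; apply: (aboveM uA uB); apply: leq_trans ij _;
  rewrite leq_add2l.
Qed.

(** D = ABA exchanges A and B by conjugation, so it anticommutes with C = A - B.
Writing D = 1 + N gives 2C = - (NC + CN), where the right-hand side lies one
step further in the filtration than C. *)
Lemma unitriangular_braid A B : unitriangular A -> unitriangular B ->
  A * B * A = B * A * B -> A = B.
Proof.
move=> uA uB braid; apply/eqP; rewrite -subr_eq0; apply/eqP.
set C := A - B; set D := A * B * A.
(* Both identities are the braid relation read inside a longer product. *)
have DA : D * A = B * D by rewrite {1}/D braid /D !mulrA.
have DB : D * B = A * D by rewrite /D [in RHS]braid !mulrA.
have DC : D * C = - (C * D) by rewrite mulrBr mulrBl opprB DA DB.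
have uD : above 1 (D - 1) by do 2?apply: unitriangularM.
have C2 : C *+ 2 = - ((D - 1) * C + C * (D - 1)).
  rewrite (mulrBl C D) (mulrBr C D) mul1r mulr1 DC mulr2n.
  by rewrite [in RHS]addrACA addNr add0r opprD opprK.
apply: above_eq0; elim: n.+1 => [i j|d IH i j ij].
  (* C already vanishes below the diagonal. *)
  rewrite addn0 => ji; have := uA i j; have := uB i j.
  rewrite addn1 ltnS (ltnW ji) => /(_ isT) + /(_ isT).
  by rewrite /C !mxE => /subr0_eq -> /subr0_eq ->; rewrite subrr.
have /(_ i j ij) S0 : above d.+1 ((D - 1) * C + C * (D - 1)).
  by apply: aboveD; [rewrite -add1n | rewrite -addn1]; exact: aboveM.
have /eqP := congr1 (fun M : 'M_ _ => M i j) C2.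
by rewrite mulmxnE [X in _ == X]mxE S0 oppr0 mulrn_eq0 => /eqP.
Qed.

End UnitriangularMatrices.

(** * Unitriangular representations of free groups *)

Section SyllableMatrices.
Local Open Scope ring_scope.
Variables (X : choiceType) (xs : seq X).
Hypothesis xsP : sorted (fun x y => x != y) xs.

(** The shift along the edges labelled x of the path whose successive edges are
labelled by [xs].  The default value of [nth] is never read: a column index
i + 1 is at most [size xs]. *)
Definition step_mx (x : X) : 'M[int]_((size xs).+1) :=
  \matrix_(i, j) ((j == i.+1 :> nat) && (x == nth x xs i))%:R.

Definition sign (b : bool) : int := if b then 1 else -1.

Definition letter_mx (l : X * bool) : 'M[int]_((size xs).+1) :=
  1 + sign l.2 *: step_mx l.1.

(** Two consecutive edges of the path have distinct labels. *)
Lemma step_mx_sq x : step_mx x * step_mx x = 0.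
Proof.
apply/matrixP=> i j; rewrite !mxE big1 // => k _; rewrite !mxE.
case: eqP => [ki|]; last by rewrite mul0r.
case: eqP => [xi|]; last by rewrite mul0r.
case: eqP => [jk|]; last by rewrite mulr0.
case: eqP => [xk|]; last by rewrite mulr0.
have ik : (i.+1 < size xs)%N by rewrite -ki -ltnS -jk.
by have /(sortedP x)/(_ i ik) := xsP; rewrite -ki -xk -xi eqxx.
Qed.

Lemma letter_mx_nseq m (x : X) b :
  eval_word letter_mx (nseq m (x, b)) = 1 + (sign b *+ m) *: step_mx x.
Proof.
elim: m => [|m IH].
  by rewrite /eval_word big_nil mulr0n scale0r addr0.
rewrite -[nseq _.+1 _]/([:: (x, b)] ++ nseq m (x, b)) eval_cat IH.
rewrite /eval_word big_seq1 /letter_mx /=.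
rewrite mulrDl mul1r mulrDr mulr1 -scalerAl -scalerAr step_mx_sq !scaler0 addr0.
by rewrite -addrA -scalerDl -mulrSr.
Qed.

Lemma letter_mxV x b : letter_mx (x, b) * letter_mx (x, ~~ b) = 1.
Proof.
rewrite /letter_mx /= mulrDl mul1r mulrDr mulr1 -scalerAl -scalerAr step_mx_sq.
rewrite !scaler0 addr0 -addrA -scalerDl.
by case: b; rewrite /sign ?subrr ?addNr scale0r addr0.
Qed.

Lemma letter_mx_unitriangular w : unitriangular (eval_word letter_mx w).
Proof.
elim: w => [|l w IH]; first by rewrite /eval_word big_nil; exact: unitriangular1.
rewrite -cat1s eval_cat; apply: unitriangularM IH.
rewrite /eval_word big_seq1 /unitriangular /letter_mx addrC addKr => i j ij.
rewrite !mxE; case: eqP => [ji|]; last by rewrite mulr0.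
by rewrite ji addn1 ltnn in ij.
Qed.

Lemma step_mxE x (i j : 'I_(size xs).+1) (A : 'M_((size xs).+1)) :
    (i < size xs)%N ->
  (step_mx x * A) i j = (x == nth x xs i)%:R * A (inord i.+1) j.
Proof.
move=> ik; rewrite mxE (bigD1 (inord i.+1)) //= big1 => [|k ki].
  by rewrite addr0 mxE inordK // eqxx.
rewrite mxE; case: eqP => [kE|_]; last by rewrite mul0r.
by rewrite -kE inord_val eqxx in ki.
Qed.

End SyllableMatrices.

Section FreeGroups.
Local Open Scope ring_scope.
Variable X : choiceType.

(** The syllable (x, b, n) stands for n + 1 copies of the letter (x, b). *)
Definition spell (s : seq (X * bool * nat)) : word X :=
  flatten [seq nseq sy.2.+1 sy.1 | sy <- s].

Definition letters (s : seq (X * bool * nat)) : seq X := [seq sy.1.1 | sy <- s].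

Definition alternates (s : seq (X * bool * nat)) :=
  sorted (fun x y => x != y) (letters s).

(** A letter put in front of a normal form is absorbed by the first syllable,
shortens it, deletes it, or starts a new one.  In the third case the tail
still alternates. *)
Lemma syllable_normal_form R (w : word X) :
  exists2 s, alternates s & pres_eq R w (spell s).
Proof.
elim: w => [|[x b] w [s As ws]]; first by exists [::] => //; exact: PresRefl.
have {ws}: pres_eq R ((x, b) :: w) ((x, b) :: spell s).
  exact: (PresCat (PresRefl R [:: (x, b)]) ws).
set u := (x, b) :: w => us.
case: s As us => [|[[y c] n] s] As us; first by exists [:: (x, b, 0%N)].
have [xy|xy] := eqVneq x y; last first.
  by exists [:: (x, b, 0%N), (y, c, n) & s] => //; rewrite /alternates /= xy.
rewrite {}xy in us *; have [bc|bc] := eqVneq b c.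
  by exists ((y, c, n.+1) :: s) => //; rewrite bc in us.
have {bc} cb : c = ~~ b by move: bc; clear; case: b; case: c.
rewrite cb /spell /= -/(spell s) in us.
have cancel v : pres_eq R [:: (y, b), (y, ~~ b) & v] v.
  exact: (PresCat (PresCancel R y b) (PresRefl R v)).
(* The new letter cancels one letter of the first syllable. *)
case: n As us => [|n] As us.
  exists s; first by rewrite /alternates (path_sorted As).
  exact: PresTrans us (cancel _).
exists ((y, c, n) :: s) => //; rewrite cb.
exact: PresTrans us (cancel _).
Qed.

(** Each syllable is 1 plus a multiple of a shift, hence moves at most one step
along the path, and there are as many syllables as edges: the only way to
go from one end to the other takes a step at every syllable.  The induction on
suffixes adds that the end is out of reach from any vertex before the start of
the suffix; the last column of the matrix records this. *)
Lemma spell_corner s0 (xs := letters s0) s pre (i : 'I_(size xs).+1) :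
    alternates s0 -> letters s0 = pre ++ letters s -> 
  let E := eval_word (letter_mx xs) (spell s) in
  ((i < size pre)%N -> E i ord_max = 0) /\
  (i = size pre :> nat -> E i ord_max <> 0).
Proof.
move=> As0; elim: s pre i => [|[[x b] n] s IH] pre i Dxs /=.
  have xsE : size xs = size pre by rewrite /xs Dxs cats0.
  have ixs : (i == size xs :> nat) = (i == size pre :> nat) by congr (_ == _).
  rewrite /eval_word big_nil !mxE -val_eqE /= ixs.
  by split=> [/ltn_eqF->|->]; rewrite ?eqxx.
set E := eval_word (letter_mx xs) (spell s).
have -> : eval_word (letter_mx xs) (spell ((x, b, n) :: s)) i ord_max
    = E i ord_max + (sign b *+ n.+1) * (step_mx xs x * E) i ord_max.
  rewrite -[spell _]/(nseq n.+1 (x, b) ++ spell s) eval_cat letter_mx_nseq //.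
  by rewrite mulrDl mul1r -scalerAl [LHS]mxE [X in _ + X = _]mxE.
have Dxs' : letters s0 = rcons pre x ++ letters s by rewrite cat_rcons.
have E0 (j : 'I_(size xs).+1) : (j <= size pre)%N -> E j ord_max = 0.
  by move=> jp; apply: (IH (rcons pre x) j Dxs').1; rewrite size_rcons.
have pk : (size pre < size xs)%N.
  by rewrite /xs Dxs' size_cat size_rcons leq_addr.
have ik : (i <= size pre)%N -> (i < size xs)%N by move=> /leq_ltn_trans->.
have xp : nth x xs (size pre) = x by rewrite /xs Dxs nth_cat ltnn subnn.
split=> ip.
  rewrite step_mxE ?ik ?(ltnW ip) // !E0 ?inordK ?ltnS ?ik // ?(ltnW ip) //.
  by rewrite !mulr0 addr0.
rewrite step_mxE ?ik ?ip // E0 ?ip // add0r xp eqxx mul1r.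
apply/eqP; rewrite mulf_neq0 //; first by rewrite mulrn_eq0; case: (b).
apply/eqP; apply: (IH (rcons pre x) _ Dxs').2.
by rewrite inordK ?size_rcons.
Qed.

(** The normal form of a b^-1 is empty: otherwise its syllables define a
unitriangular representation in which a and b agree by [unitriangular_braid]
while a b^-1 has a nonzero corner entry. *)
Lemma free_group_braid (a b : free_group X) :
  (a * b * a = b * a * b)%g -> a = b.
Proof.
have [u ->] := pres_class_surj a; have [v ->] := pres_class_surj b.
rewrite (pres_classM _ u v) (pres_classM _ v u) !pres_classM.
move=> /pres_classP braid; apply/pres_classP.
have [s As uvs] := syllable_normal_form (fun _ _ => False) (u ++ invword v).
have s_nil : s = [::].
  apply/eqP; apply: contraT => s0.
  pose f := eval_word (letter_mx (letters s)).
  have fE w w' : pres_eq (fun _ _ => False) w w' -> f w = f w'.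
    by apply: eval_pres_eq => // x c; exact: letter_mxV.
  have fM w w' : f (w ++ w') = f w * f w' by exact: eval_cat.
  have fuv : f u = f v.
    apply: unitriangular_braid; do ?exact: letter_mx_unitriangular.
    by rewrite -!fM; exact: fE.
  have fs : f (spell s) = 1.
    rewrite -(fE _ _ uvs) fM fuv -fM (fE _ _ (invwordr _ v)).
    by rewrite /f /eval_word big_nil.
  have [_ /(_ erefl)] := @spell_corner s s [::] ord0 As erefl.
  rewrite -/f fs mxE -val_eqE /= size_map.
  by case: (s) s0.
apply/pres_classP/divg1_eq.
rewrite -[(_^-1)%g]/(pres_inv _) pres_invE pres_classM.
by apply/pres_classP; rewrite s_nil in uvs.
Qed.

End FreeGroups.

Theorem mainTheorem9 (Gam : coxeter_graph) :
  has_A_subgraph Gam 2 -> ~ residually_free (artin_group Gam).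
Proof.
case=> p [p_inj pE pL] resfree.
pose s := p ord0; pose t := p ord_max.
have st : s != t by apply/eqP=> /p_inj.
have est : edge s t by rewrite pE.
pose a : artin_group Gam := pres_class _ [:: (s, true)].
pose b : artin_group Gam := pres_class _ [:: (t, true)].
have braid : (a * b * a = b * a * b)%g.
  rewrite /a /b (pres_classM _ [:: (s, true)] [:: (t, true)]).
  rewrite (pres_classM _ [:: (t, true)] [:: (s, true)]) !pres_classM.
  apply/pres_classP/PresRel.
  by exists s, t, 3; split; rewrite // /coxeter_m est pL.
have [|X [f []]] := resfree (a / b)%g.
  move=> /divg1_eq /pres_classP /artin_generator_inj /eqP; exact/negP.
apply: (mulIg (f b)); rewrite mul1g -gmulfM divgK.
by apply: free_group_braid; rewrite -!gmulfM braid.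
Qed.
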